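(* For each nonnegative integer $n$ and generalized ordered sets $X_0,\dots,X_n$, the cartesian product $\prod_{i=0}^nX_i$ with the lexicographic order is a generalized ordered set.
   Context: The setting is constructive mathematics: no use of the law of excluded middle. For a set $X$ with a binary relation $<$, write $x\leq_{P}y$ if for all $z\in X$, $z<x$ implies $z<y$, and $y<z$ implies $x<z$. A generalized ordered set is a set $X$ with a binary relation $<$ such that for all $x,y,z\in X$: (asymmetry) $x<y$ implies $\neg(y<x)$; (transitivity) $x<y$ and $y<z$ imply $x<z$; (positive antisymmetry) $x\leq_{P}y$ and $y\leq_{P}x$ imply $x=y$. The product $\prod_{i=0}^nX_i$ has componentwise equality. Its lexicographic order is $(x_0,\dots,x_n)<(y_0,\dots,y_n)$ iff there is $k\in\{0,\dots,n\}$ with $x_k<y_k$ and $x_j=y_j$ for all $j<k$. *)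

(* Defs.v *)
From Corelib Require Import RelationClasses Morphisms.
From mathcomp Require Import all_boot.

(** A set in constructive (Bishop-style) mathematics is a type together with
    its own equality, an equivalence relation, and relations on it respect that
    equality.  Hence [eqX] below: in the product it is componentwise equality,
    which for functions is not Leibniz equality. *)

Definition le_pos {X : Type} (ltX : X -> X -> Prop) (x y : X) : Prop :=
  forall z : X, (ltX z x -> ltX z y) /\ (ltX y z -> ltX x z).

Record generalized_ordered_set (X : Type) (eqX ltX : X -> X -> Prop) : Prop :=
  GeneralizedOrderedSet {
    gos_equiv : Equivalence eqX;
    gos_lt_proper : Proper (eqX ==> eqX ==> iff) ltX;
    gos_asym : forall x y : X, ltX x y -> ~ ltX y x;
    gos_trans : forall x y z : X, ltX x y -> ltX y z -> ltX x z;
    gos_pos_antisym : forall x y : X, le_pos ltX x y -> le_pos ltX y x -> eqX x y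
  }.

Definition prod_eq {n : nat} {X : 'I_n.+1 -> Type}
    (eqX : forall i, X i -> X i -> Prop) (x y : forall i, X i) : Prop :=
  forall i, eqX i (x i) (y i).

Definition lex_lt {n : nat} {X : 'I_n.+1 -> Type}
    (eqX ltX : forall i, X i -> X i -> Prop) (x y : forall i, X i) : Prop :=
  exists k : 'I_n.+1,
    ltX k (x k) (y k) /\ forall j : 'I_n.+1, j < k -> eqX j (x j) (y j).

(* Main.v *)
Require Import Defs.
From Corelib Require Import RelationClasses Morphisms.
From mathcomp Require Import all_boot.

(** For positive antisymmetry one shows, by strong induction on [i], that the
    [i]-th components of [x] and [y] agree.  To compare [x i] with [y i], replace
    one component of [x] (or [y]) by a test element [z] and use the lexicographic
    hypothesis; the resulting lexicographic inequality may be witnessed at an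
    index [k].  If [k < i] it contradicts irreflexivity, if [k = i] it is the
    desired inequality, and if [k > i] it yields [y i < x i], hence [y < x]
    lexicographically, hence [y < y], which is absurd. *)

Section Lexicographic.

Context {n : nat} {X : 'I_n.+1 -> Type}.
Context {eqX ltX : forall i : 'I_n.+1, X i -> X i -> Prop}.
Hypothesis HX :
  forall i : 'I_n.+1, generalized_ordered_set (X i) (eqX i) (ltX i).

#[local] Instance component_equiv i : Equivalence (eqX i) :=
  gos_equiv _ _ _ (HX i).
#[local] Instance component_lt_proper i :
  Proper (eqX i ==> eqX i ==> iff) (ltX i) := gos_lt_proper _ _ _ (HX i).

(** If [a] and [b] were equal, replacing both arguments of [a < b] along that equality would give
    [b < a], against asymmetry. *)
Lemma component_lt_neq i (a b : X i) : ltX i a b -> ~ eqX i a b.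
Proof.
move=> ltab eqab; apply: (gos_asym _ _ _ (HX i) _ _ ltab).
exact: (proj1 (component_lt_proper i _ _ eqab _ _ (symmetry eqab)) ltab).
Qed.

Lemma prod_eq_equiv : Equivalence (prod_eq eqX).
Proof.
split; first by move=> x i; reflexivity.
  by move=> x y exy i; symmetry; apply: exy.
by move=> x y z exy eyz i; transitivity (y i).
Qed.

Lemma lex_lt_proper :
  Proper (prod_eq eqX ==> prod_eq eqX ==> iff) (lex_lt eqX ltX).
Proof.
have imp x x' y y' : prod_eq eqX x x' -> prod_eq eqX y y' ->
    lex_lt eqX ltX x y -> lex_lt eqX ltX x' y'.
  move=> ex ey [k [ltk eqk]]; exists k; split.
    exact: (proj1 (component_lt_proper k _ _ (ex k) _ _ (ey k))).
  move=> j ltjk; transitivity (x j); first by symmetry; apply: ex.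
  by transitivity (y j); [apply: eqk | apply: ey].
move=> x x' ex y y' ey; split; first exact: imp.
by apply: imp => i; symmetry; [apply: ex | apply: ey].
Qed.

(** The smaller of the two witnessing indices is a witness for the composite. The case split is
    constructive because the order on indices is decidable. *)
Lemma lex_lt_trans x y z :
  lex_lt eqX ltX x y -> lex_lt eqX ltX y z -> lex_lt eqX ltX x z.
Proof.
move=> [k [ltk eqk]] [l [ltl eql]].
have [lkl|llk|/val_inj ekl] := ltngtP k l.
- exists k; split; last first.
    move=> j ltjk; transitivity (y j); first exact: eqk.
    exact: (eql _ (ltn_trans ltjk lkl)).
  have exx : eqX k (x k) (x k) by reflexivity.
  exact: (proj1 (component_lt_proper k _ _ exx _ _ (eql k lkl))).
- exists l; split; last first.
    move=> j ltjl; transitivity (y j); last exact: eql.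
    exact: (eqk _ (ltn_trans ltjl llk)).
  have ezz : eqX l (z l) (z l) by reflexivity.
  exact: (proj2 (component_lt_proper l _ _ (eqk l llk) _ _ ezz)).
- subst l; exists k; split; first exact: (gos_trans _ _ _ (HX k) _ _ _ ltk ltl).
  by move=> j ltjk; transitivity (y j); [apply: eqk | apply: eql].
Qed.

Lemma lex_lt_irrefl x : ~ lex_lt eqX ltX x x.
Proof. by move=> [k [/component_lt_neq ltk _]]; apply: ltk; reflexivity. Qed.

Lemma lex_lt_asym x y : lex_lt eqX ltX x y -> ~ lex_lt eqX ltX y x.
Proof. by move=> ltxy /(lex_lt_trans _ _ _ ltxy) /lex_lt_irrefl. Qed.

Lemma lex_le_pos_component x y (i : 'I_n.+1) :
  le_pos (lex_lt eqX ltX) x y ->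
  (forall j : 'I_n.+1, j < i -> eqX j (x j) (y j)) ->
  le_pos (ltX i) (x i) (y i).
Proof.
move=> lexy eqi.
have nlt : ~ ltX i (y i) (x i).
  (* The test element is [y] itself: [lexy] turns [y < x] into [y < y]. *)
  move=> lti; apply: (@lex_lt_irrefl y); apply: (proj1 (lexy y)).
  by exists i; split=> // j ltji; symmetry; apply: eqi.
have out (w : forall j, X j) (z : X i) (j : 'I_n.+1) :
    j < i -> dfwith w z j = w j.
  by move=> ltji; rewrite dfwith_out // eq_sym neq_ltn ltji.
move=> z; split=> ltz.
  have : lex_lt eqX ltX (dfwith x z) y.
    apply: (proj1 (lexy _)); exists i; split; first by rewrite dfwith_in.
    by move=> j /out ->; reflexivity.
  move=> [k [ltk eqk]]; have [lki|lik|/val_inj eki] := ltngtP k i.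
  - by move: ltk; rewrite out // => /component_lt_neq []; apply: eqi.
  (* Agreement below [k] includes the modified index [i], so [z] equals [y i] and [z < x i] becomes
     [y i < x i]. *)
  - have := eqk i lik; rewrite dfwith_in => ezy; case: nlt.
    have exx : eqX i (x i) (x i) by reflexivity.
    exact: (proj1 (component_lt_proper i _ _ ezy _ _ exx)).
  - by subst k; move: ltk; rewrite dfwith_in.
have : lex_lt eqX ltX x (dfwith y z).
  apply: (proj2 (lexy _)); exists i; split; first by rewrite dfwith_in.
  by move=> j /out ->; reflexivity.
move=> [k [ltk eqk]]; have [lki|lik|/val_inj eki] := ltngtP k i.
- by move: ltk; rewrite out // => /component_lt_neq []; apply: eqi.
(* Here [z] equals [x i] instead, so [y i < z] again gives [y i < x i]. *)
- have := eqk i lik; rewrite dfwith_in => exz; case: nlt.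
  have eyy : eqX i (y i) (y i) by reflexivity.
  exact: (proj2 (component_lt_proper i _ _ eyy _ _ exz)).
- by subst k; move: ltk; rewrite dfwith_in.
Qed.

Lemma lex_pos_antisym x y :
  le_pos (lex_lt eqX ltX) x y -> le_pos (lex_lt eqX ltX) y x ->
  prod_eq eqX x y.
Proof.
move=> lexy leyx i; have [m] := ubnP (val i).
(* Induction on a strict bound [m] for [i] makes the hypothesis available at every smaller index. *)
elim: m i => // m IHm i; rewrite ltnS => leim.
have eqi (j : 'I_n.+1) : j < i -> eqX j (x j) (y j).
  by move=> ltji; apply: IHm; apply: leq_trans leim.
apply: (gos_pos_antisym _ _ _ (HX i)); apply: lex_le_pos_component => //.
by move=> j ltji; symmetry; apply: eqi.
Qed.

End Lexicographic.

Theorem theorem20 (n : nat) (X : 'I_n.+1 -> Type)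
    (eqX ltX : forall i : 'I_n.+1, X i -> X i -> Prop)
    (HX : forall i : 'I_n.+1, generalized_ordered_set (X i) (eqX i) (ltX i)) :
  generalized_ordered_set (forall i : 'I_n.+1, X i)
    (prod_eq eqX) (lex_lt eqX ltX).
Proof.
split.
- exact: prod_eq_equiv HX.
- exact: lex_lt_proper HX.
- exact: lex_lt_asym HX.
- exact: lex_lt_trans HX.
- exact: lex_pos_antisym HX.
Qed.
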